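(* For a composition $\alpha$, write $\rho(\psi_\alpha)=\sum_\beta c_\beta\psi_\beta$. Then for every composition $\beta$, $c_\beta=\mathrm{MaxOne}^{\otimes l(\beta)}\Delta_{\beta^{\mathrm{rev}}}(\psi_\alpha)$.
   Context: $\mathrm{QSym}$ is the algebra of quasisymmetric functions over $\mathbb{C}$, with monomial basis $M_\alpha=\sum_{i_1<\dots<i_k}x_{i_1}^{\alpha_1}\cdots x_{i_k}^{\alpha_k}$ and fundamental basis $L_\alpha=\sum_{\beta\text{ refines }\alpha}M_\beta$. For a composition $\alpha$ of length $l(\alpha)$, $\alpha^{\mathrm{rev}}$ is its reversal. Let $\pi(\alpha)=\prod_{i=1}^{l}(\alpha_1+\cdots+\alpha_i)$; if $\alpha$ refines $\beta$, let $\alpha^{(i)}$ be the parts of $\alpha$ summing to $\beta_i$ and $\pi(\alpha,\beta)=\prod_i\pi(\alpha^{(i)})$. Define $\psi_\alpha=\sum_{\beta\text{ coarsens }\alpha}\frac{1}{\pi(\alpha,\beta)}M_\beta$. $\rho$ is the linear automorphism of $\mathrm{QSym}$ with $\rho(L_\alpha)=L_{\alpha^{\mathrm{rev}}}$. $\mathrm{MaxOne}$ is the linear functional with $\mathrm{MaxOne}(L_\alpha)=(-1)^k$ if $\alpha=(n-k,1^k)$ for some $0\le k<n$ and $0$ otherwise. The coproduct is $\Delta(M_\alpha)=\sum_{\beta\cdot\gamma=\alpha}M_\beta\otimes M_\gamma$ (deconcatenation, $M_\varnothing=1$), and for a composition $\gamma$ of length $l$, $\Delta_\gamma$ is the $(l-1)$-fold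 iterated coproduct followed by projection onto $\mathrm{QSym}_{\gamma_1}\otimes\cdots\otimes\mathrm{QSym}_{\gamma_l}$. *)

(* Defs.v *)
From HB Require Import structures.
From mathcomp Require Import all_boot all_order all_algebra.
From mathcomp Require Import finmap.
From mathcomp Require Import mathcomp_extra boolp classical_sets functions.
From mathcomp Require Import reals complex monalg zify.

Set Implicit Arguments.
Unset Strict Implicit.
Unset Printing Implicit Defensive.

Import GRing.Theory.

Record composition := Composition {
  parts :> seq nat;
  parts_gt0 : all (leq 1) parts }.

HB.instance Definition _ := [isSub for parts].
HB.instance Definition _ := [Choice of composition by <:].

Lemma crev_subproof (a : composition) : all (leq 1) (rev a).
Proof. by rewrite all_rev parts_gt0. Qed.
Definition crev a := Composition (crev_subproof a).

Lemma ctake_subproof k (a : composition) : all (leq 1) (take k a).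
Proof. by apply/allP => x /mem_take; apply/allP/parts_gt0. Qed.
Definition ctake k a := Composition (ctake_subproof k a).

Lemma cdrop_subproof k (a : composition) : all (leq 1) (drop k a).
Proof. by apply/allP => x /mem_drop; apply/allP/parts_gt0. Qed.
Definition cdrop k a := Composition (cdrop_subproof k a).

Definition cnil : composition := @Composition [::] isT.

Fixpoint compseqs (n : nat) : seq (seq nat) :=
  if n is n'.+1 then
    flatten [seq if s is h :: t then [:: 1 :: s; h.+1 :: t] else [:: [:: 1]]
            | s <- compseqs n']
  else [:: [::]].

Definition comps (n : nat) : seq composition := pmap insub (compseqs n).

Lemma compseqs_gt0 n s : s \in compseqs n -> all (leq 1) s.
Proof.
elim: n s => [|n IHn] s /=; first by rewrite inE => /eqP ->.
case/flattenP => u /mapP[t /IHn]; case: t => [|h t] /= tP ->.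
  by rewrite inE => /eqP ->.
by rewrite !inE => /orP[] /eqP -> //=; case/andP: tP.
Qed.

Lemma mem_compseqs n s : (s \in compseqs n) = all (leq 1) s && (sumn s == n).
Proof.
apply/idP/andP => [sn|[s0 /eqP <-]]; first split; first exact: compseqs_gt0 sn.
  elim: n s sn => [|n IHn] s /=; first by rewrite inE => /eqP ->.
  case/flattenP => u /mapP[t /IHn /eqP tn ->]; case: t tn => [|h t] /= <-.
    by rewrite inE => /eqP ->.
  by rewrite !inE => /orP[] /eqP -> /=.
move: s s0; clear n; suff H n s : sumn s = n -> all (leq 1) s -> s \in compseqs n.
  by move=> s; apply: H.
elim: n s => [|n IHn] [|[|[|h]] s] //= sn.
- move=> s0; apply/flattenP.
  exists (if s is h :: t then [:: 1 :: s; h.+1 :: t] else [:: [:: 1]]).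
    by apply/mapP; exists s => //; apply: IHn => //; case: sn.
  by case: s {sn s0} => [|h t]; rewrite !inE eqxx.
- move=> s0; apply/flattenP; exists [:: [:: 1, h.+1 & s]; h.+2 :: s].
    by apply/mapP; exists (h.+1 :: s) => //; apply: IHn => //; case: sn.
  by rewrite !inE eqxx orbT.
Qed.

Lemma uniq_compseqs n : uniq (compseqs n).
Proof.
elim: n => [//|n IHn] /=.
have pos s : s \in compseqs n -> all (leq 1) s by apply: compseqs_gt0.
elim: (compseqs n) IHn pos => [//|s l IHl] /= /andP[sl ul] pos.
have s0 : all (leq 1) s by apply: pos; rewrite mem_head.
have l0 t : t \in l -> all (leq 1) t by move=> tl; apply: pos; rewrite inE tl orbT.
rewrite cat_uniq IHl // andbT; apply/andP; split; first by case: s {sl pos} s0 => [|[|h] t].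
apply/hasPn => x /flattenP[u /mapP[t tl ->]] xu; apply/negP => xs.
case: s sl s0 xs {pos IHl} => [|h s] sl s0; rewrite !inE => xs; move/l0: (tl) => t0;
  (have nst : t <> h :: s by move=> ts; rewrite -ts tl in sl) ||
  (have nst : t <> [::] by move=> ts; rewrite -ts tl in sl);
  case: t {tl} nst t0 xu => [|g t] nst t0; rewrite !inE => xu.
- exact: nst.
- by case/orP: xu xs => /eqP-> /eqP[] //; case: g {nst} t0.
- by move: xs; rewrite (eqP xu) => /orP[] /eqP[] // h0; rewrite -h0 in s0.
case/orP: xu xs => /eqP-> /orP[] /eqP[].
- by move=> gh ts; apply: nst; rewrite gh ts.
- by move=> h0; rewrite -h0 in s0.
- by move=> h0; rewrite h0 in t0.
- by move=> gh ts; apply: nst; rewrite gh ts.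
Qed.

Lemma mem_comps n (a : composition) : (a \in comps n) = (sumn a == n).
Proof. by rewrite mem_pmap_sub mem_compseqs parts_gt0. Qed.

Lemma uniq_comps n : uniq (comps n).
Proof. exact/pmap_sub_uniq/uniq_compseqs. Qed.

(* [blocks s b] cuts s greedily into consecutive runs, the i-th one being the
   shortest with sum at least b_i; by [refinesP] and [blocksK] these are the
   runs with sums b_1, b_2, ... whenever such a decomposition of s exists.    *)
Fixpoint cut_sum (n : nat) (s : seq nat) : seq nat * seq nat :=
  if s is x :: s' then
    if n is 0 then ([::], s) else
    let: (u, v) := cut_sum (n - x) s' in (x :: u, v)
  else ([::], [::]).

Fixpoint blocks (s b : seq nat) : seq (seq nat) :=
  if b is n :: b' then
    let: (u, v) := cut_sum n s in u :: blocks v b'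
  else [::].

(* [refines a b]: a refines b, i.e. b coarsens a. *)
Definition refines (a b : composition) : bool :=
  (flatten (blocks a b) == a) && ([seq sumn s | s <- blocks a b] == b).

Lemma cut_sum_cat u v : all (leq 1) u -> cut_sum (sumn u) (u ++ v) = (u, v).
Proof.
elim: u => [_|[//|x] u IHu] /=; first by case: v.
by move=> u0; rewrite addSn -addSn addKn IHu.
Qed.

Lemma blocksK B : all (leq 1) (flatten B) ->
  blocks (flatten B) [seq sumn s | s <- B] = B.
Proof.
elim: B => [//|u B IHB] /=; rewrite all_cat => /andP[u0 B0].
by rewrite cut_sum_cat // IHB.
Qed.

Lemma refinesP (a b : composition) :
  reflect (exists B, flatten B = a /\ [seq sumn s | s <- B] = b) (refines a b).
Proof.
apply: (iffP andP) => [[/eqP aB /eqP bB]|[B [aB bB]]]; first by exists (blocks a b).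
by rewrite -aB -bB blocksK ?aB ?parts_gt0 // !eqxx.
Qed.

Definition pi1 (s : seq nat) : nat := \prod_(1 <= i < (size s).+1) sumn (take i s).
Definition pi2 (a b : composition) : nat := \prod_(s <- blocks a b) pi1 s.

(* The monomial x_{i_1}^{a_1} ... x_{i_k}^{a_k}. *)
Definition xmon (i a : seq nat) : {cmonom nat} :=
  \big[mmul/mone]_(p <- zip i a) expcmn (ucm p.1) p.2.

Lemma expcmn_ucmE i n k : expcmn (@ucm nat i) n k = (i == k) * n :> nat.
Proof.
elim: n => [|n IHn]; first by rewrite /expcmn /= onecmE muln0.
have -> : expcmn (ucm i) n.+1 = mulcm (ucm i) (expcmn (ucm i) n).
  by case: n {IHn} => [|n] //=; rewrite /expcmn /= mulcm0.
by rewrite mulcmE ucmE IHn mulnS.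
Qed.

Lemma xmonE i a k : uniq i -> size i = size a ->
  xmon i a k = nth 0 a (index k i) :> nat.
Proof.
rewrite /xmon; elim: i a => [|x i IHi] [|y a] //=; first by rewrite big_nil cm1.
move=> /andP[xi ui] [sz]; rewrite big_cons cmM IHi // expcmn_ucmE.
case: eqP => [<-|_]; last by rewrite mul0n.
by rewrite mul1n memNindex // sz nth_default ?addn0.
Qed.

Lemma sorted_ltn_uniq i : sorted ltn i -> uniq i.
Proof. by apply: sorted_uniq; [exact: ltn_trans|exact: ltnn]. Qed.

Lemma xmon_inj (a b : composition) i j : sorted ltn i -> sorted ltn j ->
  size i = size a -> size j = size b -> xmon i a = xmon j b -> i = j /\ a = b.
Proof.
move=> si sj za zb E.
have ui := sorted_ltn_uniq si; have uj := sorted_ltn_uniq sj.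
have memE (c : composition) l : sorted ltn l -> size l = size c ->
    forall k, (k \in l) = (xmon l c k != 0)%N.
  move=> sl zc k; rewrite xmonE ?sorted_ltn_uniq //.
  case kl: (k \in l).
    have /(all_nthP 0)/(_ (index k l)) := parts_gt0 c.
    by rewrite -zc index_mem kl lt0n => ->.
  by rewrite memNindex ?kl // zc nth_default ?eqxx.
have ij : i = j.
  apply: (irr_sorted_eq ltn_trans ltnn) => // k.
  by rewrite (memE a) // (memE b) // E.
split=> //; apply: val_inj; rewrite /= -{}ij in sj uj zb E *.
apply: (@eq_from_nth _ 0); rewrite -?za -?zb // => k ki.
have := congr1 (fun m : {cmonom nat} => m (nth 0 i k)) E.
by rewrite /= !xmonE // index_uniq.
Qed.

Lemma xmon_surj (m : {cmonom nat}) :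
  exists (a : composition) i, [/\ sorted ltn i, size i = size a & m = xmon i a].
Proof.
pose i := sort leq (finsupp m).
have ui : uniq i by rewrite sort_uniq fset_uniq.
have si : sorted ltn i.
  rewrite ltn_sorted_uniq_leq ui /=; exact/sort_sorted/leq_total.
have m0 : all (leq 1) [seq m k | k <- i].
  apply/allP => _ /mapP[k + ->]; rewrite mem_sort -cmE_neq0; by rewrite lt0n.
exists (Composition m0), i; split=> //=; first by rewrite size_map.
apply/eqP/cmP => k; rewrite xmonE ?size_map //=.
case ki: (k \in i); first by rewrite (nth_map 0) ?index_mem // nth_index.
rewrite memNindex ?ki // nth_default ?size_map //; apply/eqP.
by rewrite cmE_eq0 -(mem_sort leq) ki.
Qed.

Lemma mdeg_xmon i a : size i = size a -> mdeg (xmon i a) = sumn a.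
Proof.
rewrite /xmon mdeg_prod; elim: i a => [|x i IHi] [|y a] //=; first by rewrite big_nil.
move=> [sz]; rewrite big_cons IHi //; congr addn.
rewrite (@mdegEw _ _ [fset x]%fset); first by rewrite big_seq_fset1 expcmn_ucmE eqxx mul1n.
apply/fsubsetP => k; rewrite -cmE_neq0 expcmn_ucmE in_fset1 [x == k]eq_sym.
by case: (k == x).
Qed.

Local Open Scope ring_scope.

Definition bounded_degree (K : fieldType) (f : {cmonom nat} -> K^o) : Prop :=
  exists d, forall m, f m != 0 -> (mdeg m <= d)%N.

Definition quasisymmetric (K : fieldType) (f : {cmonom nat} -> K^o) : Prop :=
  forall (a : composition) (i j : seq nat),
    sorted ltn i -> sorted ltn j -> size i = size a -> size j = size a ->
    f (xmon i a) = f (xmon j a).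

Definition qsym_pred (K : fieldType) : {pred {cmonom nat} -> K^o} :=
  fun f => `[< bounded_degree f /\ quasisymmetric f >].

Record QSym (K : fieldType) := MkQSym {
  qser :> {cmonom nat} -> K^o;
  qserP : qser \in @qsym_pred K }.

Section QSymTheory.
Variable K : fieldType.

Lemma qsym_submod_closed : submod_closed (@qsym_pred K).
Proof.
split=> [|c f g /asboolP[[d fd] fq] /asboolP[[e ge] gq]]; apply/asboolP; split.
- by exists 0%N => m; rewrite /GRing.zero /= eqxx.
- by [].
- exists (maxn d e) => m; have fgE : (c *: f + g) m = c * f m + g m by [].
  rewrite fgE leq_max => h; apply/orP.
  have [f0|/fd ->] := eqVneq (f m) 0; last by left.
  have [g0|/ge ->] := eqVneq (g m) 0; last by right.
  by rewrite f0 g0 mulr0 addr0 eqxx in h.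
- move=> a i j si sj zi zj; have fgE m : (c *: f + g) m = c * f m + g m by [].
  by rewrite !fgE (fq _ i j) // (gq _ i j).
Qed.

HB.instance Definition _ :=
  GRing.isSubmodClosed.Build K _ (@qsym_pred K) qsym_submod_closed.
HB.instance Definition _ := [isSub for @qser K].
HB.instance Definition _ := [Choice of QSym K by <:].
HB.instance Definition _ := [SubChoice_isSubLmodule of QSym K by <:].

End QSymTheory.

Section LinearExtension.
Variables (K : fieldType) (B : choiceType) (V : lmodType K) (f : B -> V).

(* The linear map with <<b>> |-> f b on the free module {malg K[B]}. *)
Definition linext (x : {malg K[B]}) : V := \sum_(b <- msupp x) x@_b *: f b.

Lemma linextEw (D : {fset B}) x : (msupp x `<=` D)%fset ->
  linext x = \sum_(b <- D) x@_b *: f b.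
Proof.
move=> xD; rewrite /linext (big_fset_incl _ xD) // => b _ /mcoeff_outdom ->.
exact: scale0r.
Qed.

Lemma linext_is_linear : linear linext.
Proof.
move=> c x y; pose D := (msupp x `|` msupp y)%fset.
have xD : (msupp x `<=` D)%fset by exact: fsubsetUl.
have yD : (msupp y `<=` D)%fset by exact: fsubsetUr.
have cD : (msupp (c *: x + y) `<=` D)%fset.
  apply: fsubset_trans (msuppD_le _ _) _; rewrite fsubUset yD andbT.
  exact: fsubset_trans (msuppZ_le _ _) xD.
rewrite !(@linextEw D) // scaler_sumr -big_split; apply: eq_bigr => b _ /=.
by rewrite mcoeffD mcoeffZ scalerDl scalerA.
Qed.

HB.instance Definition _ :=
  GRing.isLinear.Build K {malg K[B]} V *:%R linext linext_is_linear.

Lemma linextU b : linext << b >> = f b.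
Proof. by rewrite /linext msuppU oner_eq0 big_seq_fset1 mcoeffUU scale1r. Qed.

End LinearExtension.

Section Bases.
Variable K : fieldType.

(* For a fixed a, distinct i give distinct monomials [xmon i a], so every
   coefficient of M_a is 0 or 1.                                              *)
Definition Mser (a : composition) : {cmonom nat} -> K^o := fun m =>
  `[< exists i, [/\ sorted ltn i, size i = size a & m = xmon i a] >]%:R.

Lemma Mser_xmon (a b : composition) i : sorted ltn i -> size i = size b ->
  Mser a (xmon i b) = (a == b)%:R.
Proof.
move=> si zi; rewrite /Mser; congr (_%:R); case: asboolP => [[j [sj zj]]|].
  by case/(xmon_inj si sj zi zj) => _ ->; rewrite eqxx.
by case: eqP => // -> []; exists i.
Qed.

Lemma Mser_subproof a : Mser a \in @qsym_pred K.
Proof.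
apply/asboolP; split; last by move=> b i j si sj zi zj; rewrite !Mser_xmon.
exists (sumn a) => m; rewrite /Mser; case: asboolP; last by rewrite eqxx.
by case=> i [_ zi ->] _; rewrite mdeg_xmon.
Qed.

Definition M (a : composition) : QSym K := MkQSym (Mser_subproof a).

Definition L (a : composition) : QSym K :=
  \sum_(b <- comps (sumn a) | refines b a) M b.

Definition psi (a : composition) : QSym K :=
  \sum_(b <- comps (sumn a) | refines a b) (pi2 a b)%:R^-1 *: M b.

Definition Mcoef (f : QSym K) (a : composition) : K :=
  f (xmon (iota 0 (size a)) a).

Lemma Mcoef_bounded (f : QSym K) :
  exists d, forall a, Mcoef f a != 0 -> (sumn a <= d)%N.
Proof.
have /asboolP[[d fd] _] := qserP f; exists d => a /fd.
by rewrite mdeg_xmon ?size_iota.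
Qed.

Definition Mbound (f : QSym K) : nat := projT1 (cid (Mcoef_bounded f)).

(* The coordinates of f in the monomial basis. *)
Definition Mcoords (f : QSym K) : {malg K[composition]} :=
  [malg a in [fset a in flatten [seq comps n | n <- iota 0 (Mbound f).+1]]%fset
     => Mcoef f a].

Lemma McoordsE f a : (Mcoords f)@_a = Mcoef f a.
Proof.
rewrite mcoeffE in_fset; case: ifPn => // /negP aD; symmetry; apply/eqP.
apply: contra_notT aD => /(projT2 (cid (Mcoef_bounded f))) ad; apply/flattenP.
exists (comps (sumn a)); last by rewrite mem_comps.
by apply/map_f; rewrite mem_iota.
Qed.

Lemma Mcoords_is_linear : linear Mcoords.
Proof. by move=> c f g; apply/malgP => a; rewrite mcoeffD mcoeffZ !McoordsE. Qed.

HB.instance Definition _ :=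
  GRing.isLinear.Build K (QSym K) {malg K[composition]} *:%R Mcoords
    Mcoords_is_linear.

Lemma sorted_iota0 n : sorted ltn (iota 0 n).
Proof. exact: iota_ltn_sorted. Qed.

Lemma McoordsM a : Mcoords (M a) = << a >>.
Proof.
apply/malgP => b; rewrite McoordsE mcoeffU /Mcoef /=.
by rewrite Mser_xmon ?size_iota // sorted_iota0.
Qed.

Lemma qserD (f g : QSym K) m : (f + g : QSym K) m = f m + g m.
Proof. by []. Qed.

Lemma qserZ c (f : QSym K) m : (c *: f : QSym K) m = c * f m.
Proof. by []. Qed.

Lemma qser_sum (T : Type) (r : seq T) (F : T -> QSym K) m :
  (\sum_(t <- r) F t : QSym K) m = \sum_(t <- r) F t m.
Proof. exact: (big_morph (fun f : QSym K => f m)). Qed.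

Lemma McoordsK : cancel Mcoords (linext M).
Proof.
move=> f; apply: val_inj; apply/funext => m /=.
have [a [i [si zi ->]]] := xmon_surj m.
have -> : f (xmon i a) = Mcoef f a.
  have /asboolP[_ fq] := qserP f.
  by apply: fq; rewrite ?size_iota // sorted_iota0.
rewrite /linext qser_sum -McoordsE.
transitivity (\sum_(b <- msupp (Mcoords f)) (Mcoords f)@_b * (b == a)%:R).
  by apply: eq_bigr => b _; rewrite qserZ /= Mser_xmon.
case: (msuppP (Mcoords f) a) => h.
  rewrite (big_fsetD1 a) //= eqxx mulr1 big1_fset ?addr0 // => b.
  by rewrite in_fsetD1 => /andP[/negPf -> _] _; rewrite mulr0.
apply: big1_fset => b bf _; case: eqP => [ba|]; last by rewrite mulr0.
by rewrite -ba bf in h.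
Qed.

Lemma linextMK : cancel (linext M) Mcoords.
Proof.
move=> x; rewrite /linext raddf_sum /= [RHS]monalgE; apply: eq_bigr => a _.
rewrite linearZ /= McoordsM; apply/malgP => b.
by rewrite mcoeffZ !mcoeffU mulr_natr.
Qed.

End Bases.

(* The tensor power QSym^{(x) l}, in coordinates: the basis vector
   << [tuple b_1; ...; b_l] >> stands for M_{b_1} (x) ... (x) M_{b_l}.        *)
Notation Tens K l := {malg K[l.-tuple composition]}.

Section Coproduct.
Variable K : fieldType.

(* Delta (x) id^{(x) l}; the pairs (b, c) of compositions with b.c = a are the
   (take k a, drop k a) with 0 <= k <= l(a).                                  *)
Definition comul_head (l : nat) : Tens K l.+1 -> Tens K l.+2 :=
  linext (fun t : l.+1.-tuple composition =>
    \sum_(k < (size (thead t)).+1)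
      << [tuple of ctake k (thead t) :: cdrop k (thead t) :: behead t] >>
      : Tens K l.+2).

(* [iter_comulS k] is the k-fold iterated coproduct QSym -> QSym^{(x) k+1}. *)
Fixpoint iter_comulS (k : nat) (f : QSym K) : Tens K k.+1 :=
  if k is k'.+1 then comul_head (iter_comulS k' f)
  else linext (fun a => << [tuple a] >> : Tens K 1) (Mcoords f).

(* The (l-1)-fold iterated coproduct QSym -> QSym^{(x) l}; for l = 0 it is the
   counit QSym -> QSym^{(x) 0} = K, i.e. the coefficient of M_{()} = 1.       *)
Definition iter_comul (l : nat) (f : QSym K) : Tens K l :=
  if l is k.+1 then iter_comulS k f else << Mcoef f cnil *g [tuple] >>.

(* Projection onto QSym_{g_1} (x) ... (x) QSym_{g_l}. *)
Definition proj_deg (g : composition) : Tens K (size g) -> Tens K (size g) :=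
  linext (fun t : (size g).-tuple composition =>
    (if [seq sumn b | b : composition <- t] == g then << t >> else 0)
      : Tens K (size g)).

Definition Delta (g : composition) (f : QSym K) : Tens K (size g) :=
  proj_deg (iter_comul (size g) f).

(* phi^{(x) l} : QSym^{(x) l} -> K^{(x) l} = K. *)
Definition tens_form (phi : QSym K -> K) (l : nat) : Tens K l -> K :=
  linext (fun t : l.-tuple composition => \prod_(b <- t) phi (M K b) : K^o).

Lemma iter_comul2_M a : iter_comul 2 (M K a) =
  \sum_(k < (size a).+1) << [tuple ctake k a; cdrop k a] >> :> Tens K 2.
Proof.
rewrite /= /comul_head McoordsM !linextU; apply: eq_bigr => k _.
by congr << _ >>; apply: val_inj.
Qed.

End Coproduct.

Lemma refines_weight a b : refines a b -> sumn a = sumn b.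
Proof.
by case/refinesP => B [<- <-]; elim: B => //= u B IHB; rewrite sumn_cat IHB.
Qed.

Lemma refines_refl a : refines a a.
Proof.
apply/refinesP; exists [seq [:: x] | x <- a]; split.
  by elim: (parts a) => //= x s ->.
by rewrite -map_comp -[RHS]map_id; apply: eq_map => x /=; rewrite addn0.
Qed.

Lemma refines_size a b : refines a b -> a != b -> (size b < size a)%N.
Proof.
case/refinesP => B []; rewrite -val_eqE /=.
have := parts_gt0 b; case: a => /= a _; case: b => /= b _ b0 aB bB.
rewrite -{a}aB -{}bB in b0 *.
suff [h1 h2] : (size B <= size (flatten B))%N /\
    (flatten B != [seq sumn s | s <- B] -> size B != size (flatten B)).
  by move=> /h2 ne; rewrite size_map ltn_neqAle ne.
elim: B b0 => [//|u B IHB] /= /andP[u0 /IHB[h1 h2]].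
case: u u0 => [//|x [|y u]] u0; rewrite /= ?addn0; split=> //.
- by rewrite eqseq_cons eqxx eqSS.
- by rewrite ltnS size_cat; apply: leq_trans h1 _; rewrite leqW ?leq_addl.
- by move=> _; rewrite eqSS neq_ltn size_cat ltnS (leq_trans h1) ?leq_addl.
Qed.

Lemma size_weight (a : composition) : (size a <= sumn a)%N.
Proof.
case: a => a /=; elim: a => //= x a IHa /andP[x0 a0].
by rewrite -add1n leq_add // IHa.
Qed.

Lemma refines_defect n (a b : composition) : refines b a -> b != a ->
  (sumn a - size a <= n.+1)%N -> (sumn b - size b <= n)%N.
Proof.
move=> ba bna; rewrite (refines_weight ba); have := refines_size ba bna.
by have := size_weight b; rewrite (refines_weight ba); lia.
Qed.

Lemma refines_defect0 (a b : composition) : refines b a -> b != a ->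
  (sumn a - size a <= 0)%N -> False.
Proof.
move=> ba bna; have := refines_size ba bna; have := size_weight b.
by rewrite (refines_weight ba); lia.
Qed.

Lemma sum_refines (V : zmodType) (a : composition) (F : composition -> V) :
  \sum_(b <- comps (sumn a) | refines b a) F b =
  F a + \sum_(b <- comps (sumn a) | refines b a && (b != a)) F b.
Proof.
rewrite big_mkcond (bigD1_seq a) ?mem_comps ?uniq_comps //= refines_refl.
congr (_ + _); rewrite [LHS]big_mkcond [RHS]big_mkcond; apply: eq_bigr => b _.
by case: refines; case: (b == a).
Qed.

(* The fundamental functions form a basis: any prescription of values on them
   extends to a linear map, and this extension is unique.                     *)
Section LExtension.
Variables (K : fieldType) (V : lmodType K) (v : composition -> V).

Fixpoint Ldual (n : nat) (a : composition) : V :=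
  v a - if n is n'.+1 then
          \sum_(b <- comps (sumn a) | refines b a && (b != a)) Ldual n' b
        else 0.

Lemma Ldual_stable n m (a : composition) :
  (sumn a - size a <= n)%N -> (sumn a - size a <= m)%N -> Ldual n a = Ldual m a.
Proof.
elim: n m a => [|n IHn] [|m] a //=.
- move=> a0 _; rewrite big_pred0 // => b.
  by apply/negP => /andP[ba bna]; exact: refines_defect0 bna a0.
- move=> _ a0; rewrite big_pred0 // => b.
  by apply/negP => /andP[ba bna]; exact: refines_defect0 bna a0.
move=> an am; congr (_ - _); apply: eq_bigr => b /andP[ba bna].
by apply: IHn; apply: refines_defect bna _.
Qed.

Lemma Ldual_sum (a : composition) :
  \sum_(b <- comps (sumn a) | refines b a) Ldual (sumn b - size b) b = v a.
Proof.
rewrite sum_refines.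
rewrite (@Ldual_stable _ (sumn a - size a).+1 a) //=.
rewrite -[RHS]addr0 -addrA; congr (_ + _); apply/eqP; rewrite addrC subr_eq0.
apply/eqP; apply: eq_bigr => b /andP[ba bna].
by apply: Ldual_stable => //; apply: refines_defect bna _.
Qed.

Lemma L_extension : exists F : {linear QSym K -> V}, forall a, F (L K a) = v a.
Proof.
pose g (a : composition) := Ldual (sumn a - size a) a.
exists (linext g \o @Mcoords K : {linear QSym K -> V}) => a.
rewrite /= /L !linear_sum /= -Ldual_sum; apply: eq_bigr => b _.
by rewrite McoordsM linextU.
Qed.

End LExtension.

Lemma L_extension_uniq (K : fieldType) (V : lmodType K)
  (F G : {linear QSym K -> V}) : (forall a, F (L K a) = G (L K a)) -> F =1 G.
Proof.
move=> FG.
have FGM n (a : composition) : (sumn a - size a <= n)%N -> F (M K a) = G (M K a).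
  elim: n a => [|n IHn] a an; have := FG a; rewrite /L;
    rewrite sum_refines !linearD /=.
    rewrite big_pred0 ?linear0 ?addr0 // => b; apply/negP.
    by move=> /andP[ba bna]; exact: refines_defect0 bna an.
  set s := \sum_(_ <- _ | _) _; suff -> : F s = G s by apply: addIr.
  rewrite /s !linear_sum; apply: eq_bigr => b /andP[ba bna].
  by apply: IHn; apply: refines_defect bna an.
move=> f; rewrite -(McoordsK f) /linext !linear_sum; apply: eq_bigr => a _.
by rewrite !linearZ /= (FGM (sumn a - size a)%N).
Qed.

Section RhoMaxOne.
Variable K : fieldType.

Definition rho : {linear QSym K -> QSym K} :=
  projT1 (cid (L_extension (fun a => L K (crev a)))).

Lemma rho_L a : rho (L K a) = L K (crev a).
Proof. exact: (projT2 (cid (L_extension (fun a => L K (crev a))))). Qed.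

Lemma crevK : involutive crev.
Proof. by move=> a; apply: val_inj; rewrite /= revK. Qed.

Lemma rhoK : involutive rho.
Proof.
have := @L_extension_uniq K _ (rho \o rho : {linear _ -> _}) (idfun : {linear _ -> _}).
by apply=> a /=; rewrite !rho_L crevK.
Qed.

Definition hook_sign (a : composition) : K^o :=
  if [pick k : 'I_(sumn a) | parts a == (sumn a - k)%N :: nseq k 1%N] is Some k
  then (-1) ^+ k else 0.

Definition MaxOne : {linear QSym K -> K^o} :=
  projT1 (cid (L_extension hook_sign)).

Lemma MaxOne_L a : MaxOne (L K a) = hook_sign a.
Proof. exact: (projT2 (cid (L_extension hook_sign))). Qed.

Lemma MaxOne_hook (a : composition) n k : (k < n)%N ->
  a = (n - k)%N :: nseq k 1%N :> seq nat -> MaxOne (L K a) = (-1) ^+ k.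
Proof.
move=> kn aE; have an : sumn a = n by rewrite aE /= sumn_nseq mul1n subnK // ltnW.
rewrite MaxOne_L /hook_sign; case: pickP => [j|/(_ (cast_ord (esym an) (Ordinal kn)))].
  by move=> /eqP/esym jE; have /(congr1 size) := etrans jE aE;
     rewrite /= !size_nseq => -[->].
by rewrite /= an aE eqxx.
Qed.

Lemma MaxOne_nonhook (a : composition) :
  (forall n k, (k < n)%N -> a <> (n - k)%N :: nseq k 1%N :> seq nat) ->
  MaxOne (L K a) = 0.
Proof.
move=> ha; rewrite MaxOne_L /hook_sign; case: pickP => // k /eqP aE.
by case: (ha (sumn a) k).
Qed.

End RhoMaxOne.

(* Main.v *)
(** A linear form on QSym is identified with the function [h] on words giving its
values on the monomial basis; deconcatenation becomes the convolution [conv].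
The map [a |-> psi_a] is compatible with deconcatenation, so evaluation at the
psi_a ([bsum]) is multiplicative for [conv].  The form
[last_form b = (-1)^(l(b) - 1) * last b] factors as [conv sgnw single_val];
since [sum a / pi a = 1 / pi (a without its last part)] and [sgnw] is inverse to
[le1], whose value at psi_a is [1 / pi a], [last_form] takes the value 1 at
psi_(n) and 0 at psi_a when l(a) <> 1.  Hence the products over the parts of beta
of its homogeneous components form the basis dual to the psi_beta.  On the other
hand rho sends M_a to M_(rev a), and MaxOne sends M_a to [(-1)^(l(a) - 1) * a_1],
so MaxOne is [last_form] composed with rho, and rho reverses convolutions. *)

Require Import Defs.
From mathcomp Require Import boolp.
From mathcomp Require Import all_boot all_order all_algebra.
From mathcomp Require Import finmap reals complex monalg zify ring.
Import GRing.Theory Num.Theory.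
Set Implicit Arguments.
Unset Strict Implicit.
Unset Printing Implicit Defensive.
Local Open Scope ring_scope.

(** * Convolution of functions on words *)

Section Convolution.
Variable K : comNzRingType.
Implicit Types (f g h : seq nat -> K) (s : seq nat).

Fixpoint conv f g s : K :=
  f [::] * g s + if s is x :: s' then conv (fun t => f (x :: t)) g s' else 0.

Definition cunit s : K := (s == [::])%:R.

Lemma convE f g s :
  conv f g s = \sum_(k < (size s).+1) f (take k s) * g (drop k s).
Proof.
elim: s f => [|x s IHs] f /=; first by rewrite big_ord1 addr0.
by rewrite big_ord_recl /= IHs.
Qed.

Lemma convDl f1 f2 g s :
  conv (fun t => f1 t + f2 t) g s = conv f1 g s + conv f2 g s.
Proof.
rewrite !convE -big_split; apply: eq_bigr => k _ /=; exact: mulrDl.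
Qed.

Lemma convZl c f g s : conv (fun t => c * f t) g s = c * conv f g s.
Proof.
by rewrite !convE mulr_sumr; apply: eq_bigr => k _ /=; rewrite mulrA.
Qed.

Lemma eq_conv_pos f1 f2 g1 g2 s : all (leq 1) s ->
  (forall t, all (leq 1) t -> f1 t = f2 t) ->
  (forall t, all (leq 1) t -> g1 t = g2 t) -> conv f1 g1 s = conv f2 g2 s.
Proof.
move=> s0 f12 g12; rewrite !convE; apply: eq_bigr => k _.
move: s0; rewrite -{1}(cat_take_drop k s) all_cat => /andP[t0 d0].
by rewrite f12 ?g12.
Qed.

Lemma convA f g h : conv f (conv g h) = conv (conv f g) h.
Proof.
apply/funext => s; elim: s f g => [|x s IHs] f g /=.
  by rewrite !addr0 mulrA.
by rewrite IHs convDl convZl; ring.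
Qed.

Lemma conv1 f : conv f cunit = f.
Proof.
apply/funext => s; elim: s f => [|x s IHs] f /=; rewrite /cunit /=.
  by rewrite mulr1 addr0.
by rewrite mulr0 add0r IHs.
Qed.

Lemma conv0l g s : conv (fun=> 0) g s = 0.
Proof. by rewrite convE big1 // => k _; rewrite mul0r. Qed.

Lemma conv1l f : conv cunit f = f.
Proof.
apply/funext => -[|x s] /=; rewrite /cunit /= mul1r ?addr0 //.
by rewrite conv0l addr0.
Qed.

Lemma conv_rcons f g s x : conv f g (rcons s x) =
  conv f (fun t => g (rcons t x)) s + f (rcons s x) * g [::].
Proof.
elim: s f => [|y s IHs] f /=; first by rewrite !addr0.
by rewrite IHs addrA.
Qed.

(** Reversing a word exchanges its prefixes and suffixes, so the two factors trade places. *)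
Lemma conv_rev f g s :
  conv f g (rev s) = conv (fun t => g (rev t)) (fun t => f (rev t)) s.
Proof.
elim: s g => [|x s IHs] g; first by rewrite /= mulrC.
rewrite rev_cons conv_rcons IHs /= addrC rev_cons mulrC; congr (_ + _).
by congr (conv _ _ s); apply/funext => t; rewrite rev_cons.
Qed.

Definition convs fs := foldr conv cunit fs.

Lemma convs_rcons fs f : convs (rcons fs f) = conv (convs fs) f.
Proof.
elim: fs => [|g fs IHfs]; first by rewrite /convs /= conv1 conv1l.
by rewrite /= IHfs convA.
Qed.

Lemma convs_rev fs s :
  convs (rev fs) (rev s) = convs [seq (fun t => f (rev t)) | f <- fs] s.
Proof.
elim: fs s => [|f fs IHfs] s.
  by rewrite /convs /= /cunit -!size_eq0 size_rev.
rewrite rev_cons convs_rcons conv_rev /=; congr (conv _ _ s).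
by apply/funext => t; rewrite IHfs.
Qed.

(** The iterated coproduct always splits its first tensor factor, which nests convolutions to the
    left, whereas [convs] nests them to the right. *)
Lemma foldl_conv f fs : foldl conv f fs = conv f (convs fs).
Proof. by elim: fs f => [|g fs IHfs] f /=; rewrite ?conv1 // IHfs convA. Qed.

End Convolution.

(** * Sums over decompositions of a word into blocks *)

Section BlockSums.
Variable K : comNzRingType.
Implicit Types (p h : seq nat -> K) (s u : seq nat).

(* The decompositions of [u ++ s] into nonempty consecutive blocks whose first
   block starts with [u].                                                     *)
Fixpoint cuts_from u s : seq (seq (seq nat)) :=
  if s is x :: s' then
    cuts_from (rcons u x) s' ++ [seq u :: B | B <- cuts_from [:: x] s']
  else [:: [:: u]].

Definition cuts s := if s is x :: s' then cuts_from [:: x] s' else [:: [::]].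

(** Since [B] flattens to [u ++ s], the bound on its head says that the first block starts with
    [u]. *)
Lemma mem_cuts_from u s B : u != [::] ->
  (B \in cuts_from u s) =
    [&& flatten B == u ++ s, [::] \notin B & (size u <= size (head [::] B))%N].
Proof.
elim: s u B => [|x s IHs] u B u0 /=.
  rewrite inE cats0; apply/eqP/and3P => [->|[/eqP Bu B0 uB]].
    by rewrite /= cats0 eqxx inE eq_sym u0 leqnn.
  case: B Bu B0 uB => [|b B] /= Bu; first by rewrite -Bu in u0.
  rewrite -Bu inE negb_or => /andP[_ B0]; rewrite size_cat.
  case: B {Bu} B0 => [|c B]; first by rewrite /= cats0.
  by case: c => [|y c]; rewrite ?inE ?eqxx //= size_cat; lia.
rewrite mem_cat IHs; last by rewrite -size_eq0 size_rcons.
rewrite cat_rcons size_rcons.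
apply/orP/and3P => [[/and3P[-> -> /ltnW //]|/mapP[C]]|[/eqP Bu B0 uB]].
  rewrite IHs // => /and3P[/eqP CE C0 _] ->.
  by rewrite /= CE eqxx inE negb_or eq_sym u0 C0 leqnn.
case: B Bu B0 uB => [|b B] /= Bu; first by case: (u) u0 Bu.
rewrite Bu eqxx inE negb_or => /andP[b0 B0]; rewrite leq_eqVlt.
case/orP => [/eqP ub|->]; last by left; rewrite B0 b0.
move/eqP: Bu; rewrite eqseq_cat // => /andP[/eqP -> /eqP BE]; right.
apply: map_f; rewrite IHs // BE eqxx B0 /=.
by case: B BE B0 => [//|[|y b'] B] _.
Qed.

Lemma uniq_cuts_from u s : u != [::] -> uniq (cuts_from u s).
Proof.
elim: s u => [//|x s IHs] u u0 /=.
have ux0 : rcons u x != [::] by rewrite -size_eq0 size_rcons.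
rewrite cat_uniq IHs // map_inj_uniq ?IHs ?andbT; [|by []|by move=> ? ? []].
apply/hasPn => _ /mapP[B _ ->]; rewrite mem_cuts_from // /= size_rcons ltnn.
by rewrite !andbF.
Qed.

Lemma mem_cuts s B : (B \in cuts s) = (flatten B == s) && ([::] \notin B).
Proof.
case: s => [|x s]; rewrite /cuts; last rewrite mem_cuts_from //.
  by rewrite inE; case: B => [|[|y b] B] //=; rewrite andbF.
by case: B => [|[|y b] B] //=; rewrite ?inE ?andbF ?andbT.
Qed.

Lemma uniq_cuts s : uniq (cuts s).
Proof. by case: s => [//|x s]; apply: uniq_cuts_from. Qed.

Definition bsum_from p h u s : K :=
  \sum_(B <- cuts_from u s) (\prod_(v <- B) p v) * h [seq sumn v | v <- B].

(* For [p v = 1 / pi(v)] this is the value at psi_s of the linear form sending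
   M_b to [h b].                                                              *)
Definition bsum p h s : K :=
  \sum_(B <- cuts s) (\prod_(v <- B) p v) * h [seq sumn v | v <- B].

Lemma bsum_nil p h : bsum p h [::] = h [::].
Proof. by rewrite /bsum big_seq1 big_nil mul1r. Qed.

Lemma bsum_cons p h x s : bsum p h (x :: s) = bsum_from p h [:: x] s.
Proof. by []. Qed.

Lemma bsum_from_nil p h u : bsum_from p h u [::] = p u * h [:: sumn u].
Proof. by rewrite /bsum_from !big_seq1. Qed.

Lemma bsum_from_cons p h u x s : bsum_from p h u (x :: s) =
  bsum_from p h (rcons u x) s +
  p u * bsum_from p (fun b => h (sumn u :: b)) [:: x] s.
Proof.
rewrite /bsum_from /= big_cat big_map mulr_sumr; congr (_ + _).
by apply: eq_bigr => B _; rewrite big_cons mulrA.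
Qed.

Lemma bsum_fromD p h1 h2 u s : bsum_from p (fun b => h1 b + h2 b) u s =
  bsum_from p h1 u s + bsum_from p h2 u s.
Proof.
by rewrite /bsum_from -big_split; apply: eq_bigr => B _; rewrite mulrDr.
Qed.

Lemma bsum_fromZ p c h u s :
  bsum_from p (fun b => c * h b) u s = c * bsum_from p h u s.
Proof.
by rewrite /bsum_from mulr_sumr; apply: eq_bigr => B _; rewrite mulrCA.
Qed.

(** A split of the list of blocks is a split of the word at a block boundary. Its left side is
    either empty or contains the first block, hence all of [u]; these are the two terms. *)
Lemma bsum_from_conv p h1 h2 u s : bsum_from p (conv h1 h2) u s =
  h1 [::] * bsum_from p h2 u s + conv (bsum_from p h1 u) (bsum p h2) s.
Proof.
elim: s u h1 => [|x s IHs] u h1.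
  by rewrite /= !bsum_from_nil bsum_nil /=; ring.
rewrite !bsum_from_cons IHs bsum_fromD bsum_fromZ IHs /=.
rewrite bsum_from_nil bsum_cons.
rewrite (_ : (fun t => bsum_from p h1 u (x :: t)) = fun t =>
    bsum_from p h1 (rcons u x) t +
    p u * bsum_from p (fun b => h1 (sumn u :: b)) [:: x] t).
  by rewrite convDl convZl; ring.
by apply/funext => t; rewrite bsum_from_cons.
Qed.

(* Dual form of: a |-> psi_a is compatible with deconcatenation. *)
Lemma bsum_conv p h1 h2 : bsum p (conv h1 h2) = conv (bsum p h1) (bsum p h2).
Proof.
apply/funext => -[|x s]; first by rewrite /= !bsum_nil.
rewrite bsum_cons bsum_from_conv /= bsum_nil bsum_cons.
by congr (_ + conv _ _ s).
Qed.

Lemma bsum_cunit p : bsum p (@cunit K) = @cunit K.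
Proof.
apply/funext => -[|x s]; first by rewrite bsum_nil.
rewrite /bsum big_seq big1 // => B; rewrite mem_cuts => /andP[/eqP BE _].
by case: B BE => // b B _; rewrite /cunit /= mulr0.
Qed.

Lemma bsum_convs p fs :
  bsum p (convs fs) = convs [seq bsum p f | f <- fs].
Proof. by elim: fs => [|f fs IHfs] /=; rewrite ?bsum_cunit // bsum_conv IHfs. Qed.

Definition hdeg n h s : K := (sumn s == n)%:R * h s.

Lemma bsum_hdeg p n h : bsum p (hdeg n h) = hdeg n (bsum p h).
Proof.
apply/funext => s; rewrite /hdeg /bsum mulr_sumr big_seq [RHS]big_seq.
apply: eq_bigr => B; rewrite mem_cuts => /andP[/eqP <- _].
by rewrite -sumn_flatten mulrCA.
Qed.

Definition single s : K := (size s == 1)%:R.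

Definition sgnw s : K := (-1) ^+ size s.

(** In the dual algebra of noncommutative symmetric functions, where a composition [b] stands for
    the complete function H_b, [le1] is the series of the H_n, [sgnw] its inverse and [single_val]
    the series of the n H_n. *)
Definition le1 s : K := (size s <= 1)%:R.

Definition single_val s : K := if s is [:: x] then x%:R else 0.

Lemma sgnw_le1 : conv sgnw le1 = @cunit K.
Proof.
apply/funext => s; case: (lastP s) => [|t x].
  by rewrite /= /sgnw /le1 /cunit /= !expr0 addr0 mulr1.
rewrite conv_rcons.
have -> : (fun t0 => le1 (rcons t0 x)) = @cunit K.
  by apply/funext => t0; rewrite /le1 /cunit size_rcons ltnS leqn0 size_eq0.
rewrite conv1 /sgnw size_rcons exprS /le1 /= mulr1 mulN1r subrr.
by rewrite /cunit -size_eq0 size_rcons.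
Qed.

(** Only the decomposition into one block survives: the induction lengthens the first block [u], and
    closing it before the end of the word leaves at least two blocks. *)
Lemma bsum_le1 p s : p [::] = 1 -> bsum p le1 s = p s.
Proof.
move=> p0; case: s => [|x s]; first by rewrite bsum_nil p0.
have: bsum_from p le1 [:: x] s = p ([:: x] ++ s); last by [].
elim: s [:: x] (isT : [:: x] != [::]) => [|y s IHs] u u0.
  by rewrite bsum_from_nil mulr1 cats0.
rewrite bsum_from_cons IHs; last by rewrite -size_eq0 size_rcons.
rewrite cat_rcons /bsum_from big_seq big1 ?mulr0 ?addr0 // => B.
rewrite mem_cuts_from //= => /and3P[/eqP BE _ _].
by case: B BE => // b B _; rewrite /le1 /= mulr0.
Qed.

Lemma bsum_single_val p s : bsum p single_val s = (sumn s)%:R * p s.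
Proof.
case: s => [|x s]; first by rewrite bsum_nil mul0r.
have: bsum_from p single_val [:: x] s =
  (sumn ([:: x] ++ s))%:R * p ([:: x] ++ s); last by [].
elim: s [:: x] (isT : [:: x] != [::]) => [|y s IHs] u u0.
  by rewrite bsum_from_nil cats0 mulrC.
rewrite bsum_from_cons IHs; last by rewrite -size_eq0 size_rcons.
rewrite cat_rcons [bsum_from _ _ _ _]/bsum_from big_seq big1 ?mulr0 ?addr0 // => B.
rewrite mem_cuts_from //= => /and3P[/eqP BE _ _].
by case: B BE => // b B _; rewrite /= mulr0.
Qed.

Lemma conv_single f s x : conv f single (rcons s x) = f s.
Proof.
rewrite conv_rcons [X in _ + X]mulr0 addr0.
have -> : (fun t => single (rcons t x)) = @cunit K; last by rewrite conv1.
by apply/funext => t; rewrite /single /cunit size_rcons eqSS size_eq0.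
Qed.

Lemma conv_single_val f s x : conv f single_val (rcons s x) = f s * x%:R.
Proof.
rewrite conv_rcons [X in _ + X]mulr0 addr0.
rewrite (_ : (fun t => _) = fun t => x%:R * cunit K t).
  by rewrite convE big_ord_recr /= big1 ?add0r
     ?take_size ?drop_size /cunit ?mulr1 // => i _;
     rewrite -size_eq0 size_drop subn_eq0 leqNgt ltn_ord !mulr0.
by apply/funext => -[|y [|z t]]; rewrite /cunit /= ?mulr1 ?mulr0.
Qed.

(** Each factor must absorb exactly one letter, and its degree fixes that letter. *)
Lemma convs_single s b : convs [seq hdeg n single | n <- b] s = (s == b)%:R.
Proof.
elim: b s => [|n b IHb] [|x s] //.
  by rewrite /= /hdeg /single /= mulr0 mul0r addr0.
rewrite /= {1}/hdeg /single /= mulr0 mul0r add0r eqseq_cons.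
transitivity (conv (fun t => (x == n)%:R * cunit K t)
    (convs [seq hdeg n single | n <- b]) s).
  congr (conv _ _ s); apply/funext => -[|y t]; rewrite /hdeg /cunit /=.
    by rewrite addn0.
  by rewrite !mulr0.
by rewrite convZl conv1l IHb -natrM mulnb.
Qed.

End BlockSums.

(** * Products of prefix sums, coarsenings and refinements *)

Lemma pi1_rcons s x : pi1 (rcons s x) = (pi1 s * (sumn s + x))%N.
Proof.
rewrite /pi1 size_rcons big_nat_recr //= -cats1 take_cat ltnNge leqnSn /=.
rewrite subSnn /= sumn_cat /= addn0; congr (_ * _)%N.
apply: eq_big_nat => i /andP[_]; rewrite ltnS take_cat => le_is.
have [//|si] := ltnP i (size s).
by rewrite (_ : i = size s) ?subnn ?cats0 ?take_size //; lia.
Qed.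

Lemma pi1_gt0 s : all (leq 1) s -> (0 < pi1 s)%N.
Proof.
elim/last_ind: s => [|s x IHs]; first by rewrite /pi1 big_nil.
by rewrite all_rcons pi1_rcons => /andP[x0 /IHs]; rewrite muln_gt0 => ->; lia.
Qed.

Lemma refines_crev a b : refines (crev a) (crev b) = refines a b.
Proof.
suff H c d : refines c d -> refines (crev c) (crev d).
  by apply/idP/idP => /H //; rewrite !crevK.
case/refinesP => B [cE dE]; apply/refinesP; exists (rev (map rev B)) => /=.
rewrite -rev_flatten cE; split=> //; rewrite map_rev -map_comp -dE.
by congr rev; apply: eq_map => s /=; rewrite sumn_rev.
Qed.

(** Coarsenings of [a] correspond to its decompositions into nonempty blocks; this turns the sum
    defining [psi] into a [bsum]. *)
Lemma perm_cuts (a : composition) :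
  perm_eq [seq blocks a (parts b) | b <- comps (sumn a) & refines a b] (cuts a).
Proof.
apply: uniq_perm; last 1 first.
- move=> B; rewrite mem_cuts; apply/mapP/andP => [[b]|[/eqP BE B0]].
    rewrite mem_filter => /andP[/andP[aE /eqP bE] _] ->; split=> //.
    apply/negP => /(map_f sumn); rewrite bE => b0.
    by have /allP/(_ _ b0) := parts_gt0 b.
  have b0 : all (leq 1) [seq sumn s | s <- B].
    apply/allP => _ /mapP[s sB ->]; case: s sB => [|x s] sB.
      by rewrite sB in B0.
    have : x \in parts a.
      by rewrite -BE; apply/flattenP; exists (x :: s); rewrite ?mem_head.
    by move/(allP (parts_gt0 a)) => /=; lia.
  have aB : blocks a [seq sumn s | s <- B] = B.
    by rewrite -{1}BE blocksK // BE parts_gt0.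
  exists (Composition b0); rewrite ?aB // mem_filter mem_comps /=.
  rewrite -sumn_flatten BE eqxx andbT; apply/refinesP; by exists B.
- rewrite map_inj_in_uniq ?filter_uniq ?uniq_comps // => b c.
  rewrite !mem_filter => /andP[/andP[_ /eqP bE] _] /andP[/andP[_ /eqP cE] _] bc.
  by apply: val_inj; rewrite /= -bE -cE bc.
- exact: uniq_cuts.
Qed.

(** Listing refinements part by part lets sums over them factor over the parts of [s]. *)
Fixpoint refinements (s : seq nat) : seq (seq nat) :=
  if s is x :: s' then [seq u ++ v | u <- compseqs x, v <- refinements s']
  else [:: [::]].

Lemma refinementsP s t :
  reflect (all (leq 1) t /\ exists B, flatten B = t /\ [seq sumn u | u <- B] = s)
          (t \in refinements s).
Proof.
elim: s t => [|x s IHs] t /=.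
  rewrite inE; apply: (iffP eqP) => [->|[_ [[|u B] [<- //]]]].
  by split=> //; exists [::].
apply: (iffP allpairsP) => [[[u v] /= [ux /IHs[v0 [B [Bv Bs]]] ->]]|].
  move: ux; rewrite mem_compseqs => /andP[u0 /eqP ux].
  by rewrite all_cat u0 v0; split=> //; exists (u :: B); rewrite /= Bv Bs ux.
case=> t0 [[|u B] [//= tE [ux Bs]]]; exists (u, flatten B) => /=.
move: t0; rewrite -tE all_cat mem_compseqs ux eqxx => /andP[-> B0].
by split=> //; apply/IHs; split=> //; exists B.
Qed.

Lemma uniq_refinements s : uniq (refinements s).
Proof.
elim: s => [//|x s IHs] /=; apply: allpairs_uniq => //; first exact: uniq_compseqs.
move=> [u v] [u' v'] /allpairsP[[w z] [wx _ [-> ->]]] {u v}.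
move=> /allpairsP[[w' z'] [wx' _ [-> ->]]] {u' v'} /= E.
move: wx wx'; rewrite !mem_compseqs /= => /andP[w0 /eqP wx] /andP[w0' /eqP wx'].
(* [cut_sum] recovers the piece of sum [x], so the concatenation determines both halves. *)
by rewrite -(cut_sum_cat z w0) -(cut_sum_cat z' w0') E wx wx'.
Qed.

Lemma perm_refinements (a : composition) :
  perm_eq [seq parts b | b <- comps (sumn a) & refines b a] (refinements a).
Proof.
apply: uniq_perm; last 1 first.
- move=> s; apply/mapP/refinementsP => [[b]|[s0 [B [sE aE]]]].
    by rewrite mem_filter => /andP[/refinesP ba _] ->; split=> //; apply: parts_gt0.
  exists (Composition s0) => //; rewrite mem_filter mem_comps /= -aE -sumn_flatten.
  by rewrite sE eqxx andbT; apply/refinesP; exists B.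
- by rewrite (map_inj_uniq val_inj) filter_uniq // uniq_comps.
- exact: uniq_refinements.
Qed.

(** * Linear forms given on the monomial basis; values of [rho] and [MaxOne] there *)

Section Forms.
Variable K : fieldType.
Implicit Types (h : seq nat -> K) (a b : composition).

Definition Mform h : {linear QSym K -> K^o} :=
  linext (fun a => h (parts a) : K^o) \o @Mcoords K.

Lemma Mform_M h a : Mform h (M K a) = h a.
Proof. by rewrite /= McoordsM linextU. Qed.

Lemma eq_linear_M (V : lmodType K) (F G : {linear QSym K -> V}) :
  (forall a, F (M K a) = G (M K a)) -> F =1 G.
Proof.
move=> FG; apply: L_extension_uniq => a; rewrite /L !linear_sum.
by apply: eq_bigr => b _.
Qed.

Lemma Mform_L h a : Mform h (L K a) = \sum_(s <- refinements a) h s.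
Proof.
rewrite /L linear_sum -(perm_big _ (perm_refinements a)) big_map big_filter.
by apply: eq_bigr => b _; rewrite Mform_M.
Qed.

(** Reversal preserves refinement, so the linear map reversing the indices of the M agrees with
    [rho] on every L. *)
Lemma rho_M a : rho K (M K a) = M K (crev a).
Proof.
pose F : {linear QSym K -> QSym K} := linext (M K \o crev) \o @Mcoords K.
have FM b : F (M K b) = M K (crev b) by rewrite /= McoordsM linextU.
rewrite -FM; apply: L_extension_uniq => {}a; rewrite rho_L /L linear_sum.
under [RHS]eq_bigr do rewrite FM.
rewrite [sumn (crev a)]sumn_rev.
have pc : perm_eq [seq crev b | b <- comps (sumn a)] (comps (sumn a)).
  apply: uniq_perm; rewrite ?(map_inj_uniq (inv_inj crevK)) ?uniq_comps // => b.
  rewrite -{1}(crevK b) (mem_map (inv_inj crevK)) !mem_comps.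
  by rewrite [sumn (crev b)]sumn_rev.
rewrite -(perm_big _ pc) big_map; apply: eq_bigl => b.
by rewrite refines_crev.
Qed.

Lemma sum_compseqsSS (f : seq nat -> K) n : \sum_(s <- compseqs n.+2) f s =
  \sum_(s <- compseqs n.+1) (f (1%N :: s) + f ((head 0%N s).+1 :: behead s)).
Proof.
rewrite (_ : compseqs n.+2 = flatten [seq
    if s is h :: t then [:: 1%N :: s; h.+1 :: t] else [:: [:: 1%N]]
    | s <- compseqs n.+1]) // big_flatten big_map big_seq [RHS]big_seq.
apply: eq_bigr => -[|x s]; first by rewrite mem_compseqs.
by rewrite big_cons big_seq1.
Qed.

(** Prepending a part 1 and increasing the first part give lengths that differ by one, so the signs
    cancel in pairs. *)
Lemma sum_compseqs_sgnw n :
  \sum_(s <- compseqs n.+1) sgnw K s = - (n == 0%N)%:R.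
Proof.
case: n => [|n]; first by rewrite big_seq1 /sgnw expr1.
rewrite sum_compseqsSS big_seq big1 ?oppr0 // => -[|x s].
  by rewrite mem_compseqs.
by rewrite /sgnw /= !exprS !mulN1r opprK subrr.
Qed.

Definition head_form (s : seq nat) : K :=
  if s is x :: t then x%:R * sgnw K t else 0.

(** The two extensions of [x :: s] contribute [- sgnw s] and [(x + 1) * sgnw s], which add up to the
    term of [x :: s] itself. *)
Lemma sum_compseqs_head n : \sum_(s <- compseqs n.+1) head_form s = 1.
Proof.
elim: n => [|n IHn]; first by rewrite big_seq1 /= /sgnw mulr1.
rewrite sum_compseqsSS -[RHS]IHn big_seq [RHS]big_seq.
apply: eq_bigr => -[|x s] sn; first by rewrite mem_compseqs in sn.
by rewrite /= /sgnw /= exprS -natr1; ring.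
Qed.

Lemma sum_refinements_cons (f : seq nat -> K) x s :
  \sum_(t <- refinements (x :: s)) f t =
  \sum_(u <- compseqs x) \sum_(v <- refinements s) f (u ++ v).
Proof. by rewrite /= big_allpairs_dep. Qed.

Lemma sum_refinements_sgnw s : all (leq 1) s ->
  \sum_(t <- refinements s) sgnw K t =
  (-1) ^+ size s * (all (pred1 1%N) s)%:R.
Proof.
elim: s => [|[//|x] s IHs] s0; first by rewrite big_seq1 mulr1.
rewrite sum_refinements_cons.
transitivity (\sum_(u <- compseqs x.+1)
  sgnw K u * \sum_(v <- refinements s) sgnw K v).
  apply: eq_bigr => u _; rewrite mulr_sumr; apply: eq_bigr => v _.
  by rewrite /sgnw size_cat exprD.
rewrite -mulr_suml sum_compseqs_sgnw IHs //= eqSS exprS.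
by case: eqP => _ /=; rewrite ?oppr0; ring.
Qed.

(** The two sides are compared on the L basis: refining the first part contributes 1, and refining
    the others gives a sign exactly when they all equal 1, which is the hook condition. *)
Lemma MaxOne_M a : MaxOne K (M K a) = head_form a.
Proof.
rewrite -Mform_M; apply: L_extension_uniq => {}a; rewrite Mform_L.
case: a => -[|[//|x] s] s0.
  by rewrite big_seq1 MaxOne_nonhook.
have s0' : all (leq 1) s by case/andP: s0.
transitivity ((-1) ^+ size s * (all (pred1 1%N) s)%:R : K); last first.
  rewrite [parts _]/= sum_refinements_cons -sum_refinements_sgnw //.
  transitivity (\sum_(u <- compseqs x.+1)
    head_form u * \sum_(v <- refinements s) sgnw K v).
    by rewrite -mulr_suml sum_compseqs_head mul1r.
  rewrite big_seq [RHS]big_seq; apply: eq_bigr => -[|y u].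
    by rewrite mem_compseqs.
  move=> _; rewrite mulr_sumr; apply: eq_bigr => v _ /=.
  by rewrite /sgnw size_cat exprD mulrA.
case: all_pred1P => [sE|nE].
  rewrite mulr1; apply: (@MaxOne_hook K _ (x.+1 + size s)%N); first by lia.
  by rewrite /= addnK -sE.
rewrite mulr0 MaxOne_nonhook // => n k kn /= [_ sE]; apply: nE.
by rewrite sE size_nseq.
Qed.

(** * Iterated coproducts and tensor products of forms *)

Definition prodform (fs : seq (seq nat -> K)) (t : seq composition) : K :=
  \prod_(p <- zip fs t) p.1 (parts p.2).

Lemma linext_linext (B C : choiceType) (V : lmodType K) (f : C -> V)
    (g : B -> {malg K[C]}) x :
  linext f (linext g x) = linext (fun y => linext f (g y)) x.
Proof.
by rewrite {2}/linext linear_sum; apply: eq_bigr => b _; rewrite linearZ.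
Qed.

Lemma eq_linext (B : choiceType) (V : lmodType K) (f g : B -> V) :
  f =1 g -> linext f =1 linext g.
Proof. by move=> fg x; apply: eq_bigr => b _; rewrite fg. Qed.

(** [comul_head] splits the first tensor factor, and evaluating two forms on the pieces evaluates
    their convolution on that factor. *)
Lemma linext_iter_comulS k f fs (x : QSym K) : size fs = k ->
  linext (fun t : k.+1.-tuple composition => prodform (f :: fs) t : K^o)
    (iter_comulS k x) = Mform (foldl (@conv K) f fs) x.
Proof.
elim: k f fs => [|k IHk] f [|g fs] // => [_|[sz]].
  rewrite /= linext_linext; apply: eq_linext => a.
  by rewrite linextU /prodform big_seq1.
rewrite [foldl _ _ _]/= -IHk // [iter_comulS _ _]/= /comul_head linext_linext; apply: eq_linext => t.
case/tupleP: t => a t; rewrite linear_sum /= theadE /prodform /= big_cons.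
rewrite [(_, a).1 _]/= convE mulr_suml; apply: eq_bigr => i _.
by rewrite linextU /= !big_cons mulrA.
Qed.

(** Restricting each factor to its own degree does the work of the projection [proj_deg]. *)
Lemma prodform_hdeg h (g : seq nat) (t : seq composition) : size t = size g ->
  prodform [seq hdeg n h | n <- g] t =
  if [seq sumn (parts b) | b <- t] == g then \prod_(b <- t) h b else 0.
Proof.
rewrite /prodform; elim: g t => [|n g IHg] [|b t] //=; first by rewrite !big_nil.
case=> sz; rewrite !big_cons IHg //= {1}/hdeg eqseq_cons.
by do 2 case: eqP => _ /=; rewrite ?mul1r ?mul0r ?mulr0.
Qed.

Lemma linext_monom (B : choiceType) (V : lmodType K) (f : B -> V) c y :
  linext f << c *g y >> = c *: f y.
Proof.
rewrite -[f y]linextU -linearZ; congr linext.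
by apply/malgP => z; rewrite mcoeffZ !mcoeffU mulr_natr.
Qed.

Lemma Mform_cunit x : Mform (@cunit K) x = Mcoef x cnil.
Proof.
rewrite /= (@linextEw _ _ _ _ (cnil |` msupp (Mcoords x))%fset) ?fsubsetUr //.
rewrite (big_fsetD1 cnil) ?fset1U1 //= /cunit eqxx McoordsE [X in X + _]mulr1.
rewrite big1_fset ?addr0 // => b; rewrite in_fsetD1 -val_eqE /= => /andP[/negPf b0 _] _.
by rewrite b0 [LHS]mulr0.
Qed.

Lemma tens_form_Delta (phi : QSym K -> K) h (g : composition) x :
  (forall a, phi (M K a) = h a) ->
  tens_form phi (Delta g x) = Mform (convs [seq hdeg n h | n <- g]) x.
Proof.
move=> phiM; rewrite /tens_form /Delta /proj_deg linext_linext.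
transitivity (linext (fun t : (size g).-tuple composition =>
    prodform [seq hdeg n h | n <- g] t : K^o) (iter_comul (size g) x)).
  apply: (@eq_linext _ K^o) => t; rewrite prodform_hdeg ?size_tuple //.
  case: ifP => _; last by rewrite linear0.
  by rewrite linextU; apply: eq_bigr => b _.
case: (parts g) => [|n s] /=.
  (* In length 0 the iterated coproduct is the counit, represented by [cunit]. *)
  by rewrite linext_monom -Mform_cunit /prodform big_nil [LHS]mulr1.
by rewrite linext_iter_comulS ?size_map // foldl_conv.
Qed.

End Forms.

(** * The basis dual to [psi] *)

Section DualBasis.
Variable K : numFieldType.
Implicit Types (h : seq nat -> K) (a b : composition).

Definition pweight (s : seq nat) : K := (pi1 s)%:R^-1.

Lemma Mform_psi h a : Mform h (psi K a) = bsum pweight h a.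
Proof.
rewrite /psi linear_sum /bsum -(perm_big _ (perm_cuts a)) big_map big_filter.
apply: eq_bigr => b /andP[_ /eqP bE]; rewrite linearZ_LR Mform_M bE [LHS]/=.
by rewrite /pi2 natr_prod -prodfV.
Qed.

(* The coefficients of the noncommutative power sum Psi_n on the complete
   functions: (-1)^(l - 1) times the last part.                               *)
Definition last_form : seq nat -> K := conv (sgnw K) (@single_val K).

Lemma head_form_rev s : head_form K (rev s) = last_form s.
Proof.
case: (lastP s) => [|t x]; first by rewrite /last_form /= mulr0 addr0.
by rewrite /last_form conv_single_val rev_rcons /= /sgnw size_rev mulrC.
Qed.

Lemma bsum_last_form s : all (leq 1) s -> bsum pweight last_form s = single K s.
Proof.
have p0 : pweight [::] = 1 by rewrite /pweight /pi1 big_nil invr1.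
(* This is Newton's identity evaluated at psi: the sum of [rcons t x] cancels the last factor of its
   [pi1]. *)
have valE t : all (leq 1) t ->
    bsum pweight (@single_val K) t = conv (bsum pweight (@le1 K)) (@single K) t.
  case: (lastP t) => [_|{}t x].
    by rewrite bsum_nil /= /single mulr0 addr0.
  rewrite all_rcons conv_single bsum_le1 // bsum_single_val => /andP[x0 t0].
  rewrite /pweight pi1_rcons natrM invfM mulrCA -cats1 sumn_cat /= addn0.
  by rewrite divff ?mulr1 // pnatr_eq0; lia.
move=> s0; rewrite /last_form bsum_conv (eq_conv_pos s0 (fun _ _ => erefl) valE).
by rewrite convA -bsum_conv sgnw_le1 bsum_cunit conv1l.
Qed.

Definition dual_form (s : seq nat) := convs [seq hdeg n last_form | n <- s].

(** Evaluation at psi is multiplicative and turns each factor into a homogeneous component of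
    [single], so [convs_single] applies. *)
Lemma dual_form_psi a b : Mform (dual_form b) (psi K a) = (a == b)%:R :> K.
Proof.
rewrite Mform_psi /dual_form bsum_convs -map_comp -val_eqE /= -convs_single.
elim: (parts b) (parts a) (parts_gt0 a) => [//|n s IHs] t t0 /=.
apply: eq_conv_pos => // u u0.
by rewrite bsum_hdeg /hdeg bsum_last_form.
Qed.

(** Reversing the word reverses the order of the factors and turns each [last_form] into
    [head_form]. *)
Lemma Mform_dual_rho b x : Mform (dual_form b) (rho K x) =
  Mform (convs [seq hdeg n (@head_form K) | n <- rev b]) x.
Proof.
pose F : {linear QSym K -> K^o} := Mform (dual_form b) \o rho K.
rewrite -[LHS]/(F x); apply: eq_linear_M => a; rewrite Mform_M.
rewrite -[LHS]/(Mform _ (rho K (M K a))) rho_M Mform_M -[in RHS](revK a) map_rev convs_rev.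
rewrite -map_comp; congr (convs _ _); apply: eq_map => n /=; apply/funext => t.
by rewrite /hdeg sumn_rev head_form_rev.
Qed.

(** Triangularity: every other M_b occurring in psi_a has fewer parts than [a], so induction on the
    length solves for M_a. *)
Lemma psi_span_M a : exists c, M K a = linext (psi K) c.
Proof.
have [n] := ubnP (size a); elim: n a => // n IHn a an.
have piK : (pi2 a a)%:R != 0 :> K.
  rewrite pnatr_eq0 -lt0n /pi2 big_seq prodn_cond_gt0 // => s sa.
  have /andP[/eqP aE _] := refines_refl a.
  apply/pi1_gt0/allP => y ys; apply: (allP (parts_gt0 a)).
  by rewrite -aE; apply/flattenP; exists s.
have [c cE] : exists c, \sum_(b <- comps (sumn a) | (b != a) && refines a b)
    (pi2 a b)%:R^-1 *: M K b = linext (psi K) c.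
  apply: (big_ind (fun x => exists c, x = linext (psi K) c)) => [|x y [c ->] [d ->]|b /andP[ba ab]].
  - by exists 0; rewrite linear0.
  - by exists (c + d); rewrite linearD.
  have [|c ->] := IHn b.
    by have := refines_size ab; rewrite eq_sym => /(_ ba); lia.
  by exists ((pi2 a b)%:R^-1 *: c); rewrite linearZ.
exists ((pi2 a a)%:R *: (<< a >> - c)).
rewrite linearZ linearB /= linextU -cE /psi.
rewrite [X in _ *: (X - _)]big_mkcond (bigD1_seq a) ?mem_comps ?uniq_comps //=.
by rewrite refines_refl -big_mkcondr addrK scalerA divff ?scale1r.
Qed.

End DualBasis.

(** * Existence and coefficients of expansions in [psi] *)

Lemma psi_span (K : numFieldType) (x : QSym K) : exists c, x = linext (psi K) c.
Proof.
rewrite -(McoordsK x) {1}/linext.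
apply: (big_ind (fun x => exists c, x = linext (psi K) c)).
- by exists 0; rewrite linear0.
- by move=> y z [c ->] [d ->]; exists (c + d); rewrite linearD.
move=> a _; have [c ->] := psi_span_M K a.
by exists ((Mcoords x)@_a *: c); rewrite linearZ.
Qed.

Lemma psi_coef (K : numFieldType) (c : {malg K[composition]}) (beta : composition) :
  Mform (dual_form K beta) (linext (psi K) c) = c@_beta.
Proof.
rewrite linear_sum.
transitivity (\sum_(b <- msupp c) c@_b * (b == beta)%:R).
  by apply: eq_bigr => b _; rewrite linearZ_LR dual_form_psi.
case: (msuppP c beta) => h.
  rewrite (big_fsetD1 beta) //= eqxx mulr1 big1_fset ?addr0 // => b.
  by rewrite in_fsetD1 => /andP[/negPf -> _] _; rewrite mulr0.
apply: big1_fset => b bc _; case: eqP => [bb|]; last by rewrite mulr0.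
by rewrite -bb bc in h.
Qed.

Theorem theorem3p9 (R : realType) (alpha : composition) :
  (exists c : {malg R[i][composition]},
     rho _ (psi R[i] alpha) = \sum_(b <- msupp c) c@_b *: psi R[i] b) /\
  (forall c : {malg R[i][composition]},
     rho _ (psi R[i] alpha) = \sum_(b <- msupp c) c@_b *: psi R[i] b ->
     forall beta : composition,
       c@_beta = tens_form (MaxOne R[i]) (Delta (crev beta) (psi R[i] alpha))).
Proof.
split=> [|c cE beta]; first exact: psi_span.
(* The expansion is tested against the form dual to psi_beta, whose composite with [rho] is the
   tensor form of [MaxOne] in the degrees of [crev beta]. *)
rewrite (tens_form_Delta _ _ (@MaxOne_M _)) -[LHS]psi_coef.
by rewrite -[linext _ c]cE Mform_dual_rho.
Qed.
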